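(* Let $X$ be a Busemann space, $C\subseteq X$ be nonempty and $T:C\to C$ be $\lambda$-firmly nonexpansive for some $\lambda\in(0,1)$. Then any periodic point of $T$ is a fixed point of $T$.
   Context: Let $(X,d)$ be a metric space. A geodesic in $X$ is a map $\gamma:[a,b]\to X$ with $d(\gamma(s),\gamma(t))=|s-t|$ for all $s,t\in[a,b]$; its image is a geodesic segment joining $\gamma(a)$ and $\gamma(b)$. $X$ is a (uniquely) geodesic space if every two distinct points are joined by a (unique) geodesic segment. A map $\gamma:[a,b]\to X$ is an affinely reparametrized geodesic if it is constant or if $\gamma=\gamma'\circ\psi$ for some geodesic $\gamma':[c,d]\to X$, where $\psi:[a,b]\to[c,d]$ is the unique (increasing) affine homeomorphism. A geodesic space $X$ is a Busemann space if for any two affinely reparametrized geodesics $\gamma:[a,b]\to X$, $\gamma':[c,d]\to X$ the map $(s,t)\mapsto d(\gamma(s),\gamma'(t))$ is convex on $[a,b]\times[c,d]$. Busemann spaces are uniquely geodesic; for $x,y\in X$ and $\lambda\in[0,1]$, $(1-\lambda)x\oplus\lambda y$ denotes the unique point $z$ with $d(x,z)=\lambda d(x,y)$ and $d(y,z)=(1-\lambda)d(x,y)$. For $C\subseteq X$ and $\lambda\in(0,1)$, a map $T:C\to X$ is $\lambda$-firmly nonexpansive if $d(Tx,Ty)\le d((1-\lambda)x\oplus\lambda Tx,(1-\lambda)y\oplus\lambda Ty)$ for all $x,y\in C$. A periodic point of $T:C\to C$ is a point $x\in C$ with $T^nx=x$ for some integer $n\ge1$. *)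

(* Defs.v *)
From mathcomp Require Import all_boot all_order all_algebra.
From mathcomp Require Import all_classical all_reals all_analysis.

Set Implicit Arguments.
Unset Strict Implicit.
Unset Printing Implicit Defensive.

Import Order.TTheory GRing.Theory Num.Theory.
Import numFieldNormedType.Exports.

Local Open Scope classical_set_scope.
Local Open Scope ring_scope.

Section Busemann.
Context {R : realType} {X : metricType R}.

(* A map [a, b] -> X is represented by a total function R -> X of which only
   the values on `[a, b] matter. *)
Definition is_geodesic (a b : R) (g : R -> X) : Prop :=
  a <= b /\ {in `[a, b] &, forall s t, mdist (g s) (g t) = `|s - t|}.

Definition geodesic_segment (x y : X) (S : set X) : Prop :=
  exists (a b : R) (g : R -> X),
    [/\ is_geodesic a b g, g a = x, g b = y & S = g @` `[a, b]].

(* line_path c d \o factor a b is t |-> c + (t - a) / (b - a) * (d - c), the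
   increasing affine homeomorphism from [a, b] onto [c, d] when a < b, c < d. *)
Definition is_affine_geodesic (a b : R) (g : R -> X) : Prop :=
  a <= b /\
  ((exists x, {in `[a, b], forall t, g t = x}) \/
   (exists (c d : R) (g' : R -> X),
      [/\ a < b, c < d, is_geodesic c d g' &
          {in `[a, b], forall t, g t = g' (line_path c d (factor a b t))}])).

(* (1 - l) x (+) l y: the point z with d(x, z) = l d(x, y) and
   d(y, z) = (1 - l) d(x, y), which exists and is unique when X is a Busemann
   space and 0 <= l <= 1. The default value x of xget is then irrelevant. *)
Definition geodesic_comb (l : R) (x y : X) : X :=
  xget x [set z | mdist x z = l * mdist x y /\
                  mdist y z = (1 - l) * mdist x y].

Definition firmly_nonexpansive (l : R) (C : set X) (T : X -> X) : Prop :=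
  forall x y, C x -> C y ->
    mdist (T x) (T y) <=
    mdist (geodesic_comb l x (T x)) (geodesic_comb l y (T y)).

Definition periodic_point (C : set X) (T : X -> X) (x : X) : Prop :=
  C x /\ exists2 n : nat, (0 < n)%N & iter n T x = x.

End Busemann.

Definition geodesic_space (R : realType) (X : metricType R) : Prop :=
  forall x y : X, x <> y -> exists S, geodesic_segment x y S.

Definition busemann_space (R : realType) (X : metricType R) : Prop :=
  geodesic_space X /\
  forall (a b c d : R) (g g' : R -> X),
    is_affine_geodesic a b g -> is_affine_geodesic c d g' ->
    @convex_function R (R^o * R^o)%type (`[a, b] `*` `[c, d])
      (fun p => mdist (g p.1) (g' p.2)).

(* Main.v *)
Require Import Defs.
From mathcomp Require Import all_boot all_order all_algebra.
From mathcomp Require Import all_classical all_reals all_analysis.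
From mathcomp Require Import ring lra.

Import Order.TTheory GRing.Theory Num.Theory.
Import numFieldNormedType.Exports.

Local Open Scope classical_set_scope.
Local Open Scope ring_scope.

(* With S_m the sum over one period of the distances d(T^k x, T^(k+m) x),
   convexity of d along the geodesics from T^k x to T^(k+1) x and from T^(k+m) x
   to T^(k+m+1) x bounds d at the parameter (l, l) by its values at the four
   corners; summing the firmness inequality over the period then gives
   2 S_m <= S_(m-1) + S_(m+1).  As S_0 = 0, this yields m S_1 <= S_m; but
   S_n = 0 for the period n, so S_1 = 0. *)

(* By the triangle inequality the Lipschitz bound is then an equality, so that
   these are the geodesics from x to y, affinely reparametrized on [0, 1]. *)
Definition shortest_path {R : realType} {X : metricType R}
    (g : R -> X) (x y : X) : Prop :=
  [/\ g 0 = x, g 1 = y & forall s t, 0 <= s -> s <= t -> t <= 1 ->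
    mdist (g s) (g t) <= (t - s) * mdist x y].

Section ShortestPath.
Context {R : realType} {X : metricType R}.
Implicit Types (g : R -> X) (x y z : X) (l : R).

Lemma shortest_path_dist {g x y s t} : shortest_path g x y ->
  0 <= s -> s <= t -> t <= 1 -> mdist (g s) (g t) = (t - s) * mdist x y.
Proof.
move=> [g0 g1 gle] s0 st t1; apply/le_anti; rewrite gle //=.
have t0 := le_trans s0 st; have s1 := le_trans st t1.
have := gle 0 s (lexx _) s0 s1; have := gle t 1 t0 t1 (lexx _).
have := metric_triangle x (g s) y; have := metric_triangle (g s) (g t) y.
rewrite g0 g1; lra.
Qed.

(** The pieces have lengths [l * mdist x y] and [(1 - l) * mdist x y], so run over [[0, l]] and
    [[l, 1]] both have speed [mdist x y]; the triangle inequality at [z] covers parameters on either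
    side of [l]. *)
Lemma shortest_path_cat {l x y z g g'} : 0 < l -> l < 1 ->
  mdist x z = l * mdist x y -> mdist y z = (1 - l) * mdist x y ->
  shortest_path g x z -> shortest_path g' z y ->
  exists2 h, shortest_path h x y & h l = z.
Proof.
move=> l0 l1 xz yz [g0 g1 gle] [g'0 g'1 g'le].
pose h t := if t <= l then g (t / l) else g' ((t - l) / (1 - l)).
have k0 : 0 < 1 - l by rewrite subr_gt0.
have hl : h l = z by rewrite /h lexx divff ?gt_eqF.
exists h => //.
have hle1 s t : 0 <= s -> s <= t -> t <= l ->
    mdist (h s) (h t) <= (t - s) * mdist x y.
  move=> s0 st tl; rewrite /h tl (le_trans st tl).
  apply: (le_trans (gle _ _ _ _ _)).
  - by rewrite divr_ge0 // ltW.
  - by rewrite ler_pM2r // invr_gt0.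
  - by rewrite ler_pdivrMr // mul1r.
  by rewrite -mulrBl xz mulrA divfK ?gt_eqF.
have hle2 s t : l <= s -> s <= t -> t <= 1 ->
    mdist (h s) (h t) <= (t - s) * mdist x y.
  (* At [u = l] the test in [h] selects [g], but both branches take the value [z] there. *)
  have hE u : l <= u -> h u = g' ((u - l) / (1 - l)).
    rewrite le_eqVlt => /predU1P[<-|lu]; first by rewrite hl subrr mul0r g'0.
    by rewrite /h leNgt lu.
  move=> ls st t1; rewrite !hE ?(le_trans ls st) //.
  apply: (le_trans (g'le _ _ _ _ _)).
  - by rewrite divr_ge0 ?subr_ge0 // ltW.
  - by rewrite ler_pM2r ?invr_gt0 // lerD2r.
  - by rewrite ler_pdivrMr // mul1r lerD2r.
  rewrite -mulrBl metric_sym yz mulrA divfK ?gt_eqF //.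
  by apply: ler_wpM2r; [exact: mdist_ge0|lra].
split.
- by rewrite /h ltW // mul0r g0.
- by rewrite /h leNgt l1 /= divff ?gt_eqF.
move=> s t s0 st t1; have [tl|/ltW lt] := leP t l; first exact: hle1.
have [sl|/ltW ls] := leP s l; last exact: hle2.
have := metric_triangle (h s) (h l) (h t).
have := hle1 _ _ s0 sl (lexx _); have := hle2 _ _ (lexx _) lt t1; lra.
Qed.

(** This makes the convexity in [busemann_space] applicable. For [x != y], dividing the parameter by
    [mdist x y] gives a unit-speed geodesic on [[0, mdist x y]]. *)
Lemma shortest_path_affine {g x y} : shortest_path g x y ->
  is_affine_geodesic 0 1 g.
Proof.
move=> gP; have [g0 _ _] := gP; split=> //.
have [xy|xy] := eqVneq x y.
  left; exists x => t; rewrite in_itv /= => /andP[t0 t1].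
  apply: mdist_positivity; rewrite -[in X in mdist _ X]g0 metric_sym.
  by rewrite (shortest_path_dist gP) // xy mdistxx mulr0.
have D0 : 0 < mdist x y by rewrite mdist_gt0.
right; exists 0, (mdist x y), (fun t => g (t / mdist x y)); split=> //.
  split; first exact: ltW.
  have gE s t : 0 <= s -> s <= t -> t <= mdist x y ->
      mdist (g (s / mdist x y)) (g (t / mdist x y)) = t - s.
    move=> s0 st t1; rewrite (shortest_path_dist gP).
    - by rewrite -mulrBl divfK // gt_eqF.
    - by rewrite divr_ge0 // ltW.
    - by rewrite ler_pM2r // invr_gt0.
    - by rewrite ler_pdivrMr // mul1r.
  move=> s t; rewrite !in_itv /= => /andP[s0 s1] /andP[t0 t1].
  have [st|/ltW ts] := leP s t; first by rewrite gE // distrC ger0_norm ?subr_ge0.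
  by rewrite metric_sym gE // ger0_norm ?subr_ge0.
move=> t _; congr g; rewrite /line_path /factor.
by rewrite mulr0 add0r !subr0 divr1 mulfK // gt_eqF.
Qed.

Hypothesis geoX : geodesic_space X.

Lemma shortest_path_exists x y : exists g, shortest_path g x y.
Proof.
have [<-|/eqP/geoX[_ [a [b [g [[ab gD] ga gb _]]]]]] := eqVneq x y.
  by exists (fun=> x); split=> // s t *; rewrite mdistxx mulr0.
have xy : mdist x y = b - a.
  by rewrite -ga -gb gD ?in_itv /= ?lexx ?ab // distrC ger0_norm // subr_ge0.
have ba0 : 0 <= b - a by rewrite subr_ge0.
exists (fun t => g (a + t * (b - a))); split.
- by rewrite mul0r addr0.
- by rewrite mul1r addrC subrK.
have itv t : 0 <= t -> t <= 1 -> a + t * (b - a) \in `[a, b].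
  move=> t0 t1; rewrite in_itv /= lerDl mulr_ge0 //=.
  by have := ler_wpM2r ba0 t1; lra.
move=> s t s0 st t1.
rewrite gD ?itv ?(le_trans s0 st) ?(le_trans st t1) // xy.
rewrite (_ : _ - _ = - ((t - s) * (b - a))); last by ring.
by rewrite normrN ger0_norm // mulr_ge0 // subr_ge0.
Qed.

(** The point [g l] of any shortest path shows that [xget] does not fall back on its default, but
    [xget] may select another point with the same two distances. A path through the selected point
    is therefore built by concatenation. *)
Lemma shortest_path_through_comb {l} x y : 0 < l -> l < 1 ->
  exists2 g, shortest_path g x y & g l = geodesic_comb l x y.
Proof.
move=> l0 l1; have [g gP] := shortest_path_exists x y.
have [g0 g1 _] := gP.
have [xz yz] : [set z | mdist x z = l * mdist x y /\
    mdist y z = (1 - l) * mdist x y] (geodesic_comb l x y).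
  apply: xgetPex; exists (g l); split.
    by rewrite -[in mdist x (g l)]g0 (shortest_path_dist gP) ?subr0 // ltW.
  by rewrite metric_sym -[in mdist (g l) y]g1 (shortest_path_dist gP) // ltW.
have [g1P g1E] := shortest_path_exists x (geodesic_comb l x y).
have [g2P g2E] := shortest_path_exists (geodesic_comb l x y) y.
exact: (shortest_path_cat l0 l1 xz yz g1E g2E).
Qed.

End ShortestPath.

Section Busemann.
Context {R : realType} {X : metricType R}.
Hypothesis busemannX : busemann_space X.

Lemma busemann_convex {g g' : R -> X} {x y x' y' : X} {l s1 s2 t1 t2 : R} :
  shortest_path g x y -> shortest_path g' x' y' -> 0 <= l <= 1 ->
  0 <= s1 <= 1 -> 0 <= s2 <= 1 -> 0 <= t1 <= 1 -> 0 <= t2 <= 1 ->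
  mdist (g (l * s1 + (1 - l) * s2)) (g' (l * t1 + (1 - l) * t2)) <=
  l * mdist (g s1) (g' t1) + (1 - l) * mdist (g s2) (g' t2).
Proof.
move=> gP g'P /andP[l0 l1] s1I s2I t1I t2I.
have := busemannX.2 _ _ _ _ _ _ (shortest_path_affine gP)
  (shortest_path_affine g'P) (Itv01 l0 l1) (s1, t1) (s2, t2).
by apply; rewrite inE /=; split; rewrite /= in_itv.
Qed.

(** The weights are those of bilinear interpolation at [(l, l)] from the corners of the unit square:
    convexity is applied once in the first parameter, then in the second parameter on the two sides
    where the first is 0 or 1. *)
Lemma dist_comb_le {l : R} (x y x' y' : X) : 0 < l -> l < 1 ->
  mdist (geodesic_comb l x y) (geodesic_comb l x' y') <=
  (1 - l) ^+ 2 * mdist x x' + l ^+ 2 * mdist y y' +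
  l * (1 - l) * (mdist x y' + mdist y x').
Proof.
move=> l0 l1.
have [g gP <-] := shortest_path_through_comb busemannX.1 x y l0 l1.
have [g' g'P <-] := shortest_path_through_comb busemannX.1 x' y' l0 l1.
have [g0 g1 _] := gP; have [g'0 g'1 _] := g'P.
have lI : 0 <= l <= 1 by rewrite !ltW.
have I0 : 0 <= (0 : R) <= 1 by rewrite lexx ler01.
have I1 : 0 <= (1 : R) <= 1 by rewrite lexx ler01.
have l10 : l * 1 + (1 - l) * 0 = l by ring.
have cst t : l * t + (1 - l) * t = t by ring.
have H := busemann_convex gP g'P lI I1 I0 lI lI.
have H0 := busemann_convex gP g'P lI I0 I0 I1 I0.
have H1 := busemann_convex gP g'P lI I1 I1 I1 I0.
move: H H0 H1; rewrite !cst !l10 g0 g1 g'0 g'1 => H H0 H1.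
have := ler_wpM2l (ltW l0) H1.
have k0 : 0 <= 1 - l by rewrite subr_ge0 ltW.
have := ler_wpM2l k0 H0.
lra.
Qed.

End Busemann.

Lemma midconvex_ge_linear {R : realType} {S : nat -> R} : S 0%N = 0 ->
  (forall m, 2 * S m.+1 <= S m + S m.+2) -> forall m, m%:R * S 1%N <= S m.
Proof.
move=> S0 SS m.
(* The increments of [S] are nondecreasing and the first one is [S 1]; the induction carries this
   bound on the increments along. *)
suff [] : m%:R * S 1%N <= S m /\ S 1%N <= S m.+1 - S m by [].
elim: m => [|m [IH1 IH2]]; first by rewrite mul0r S0 subr0.
by rewrite -natr1; have := SS m; split; lra.
Qed.

Theorem proposition4p3 (R : realType) (X : metricType R)
    (busemannX : busemann_space X)
    (C : set X) (C_nonempty : C !=set0)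
    (T : X -> X) (T_maps_C : set_fun C C T)
    (l : R) (l_gt0 : 0 < l) (l_lt1 : l < 1)
    (T_firm : firmly_nonexpansive l C T)
    (x : X) (x_periodic : periodic_point C T x) :
  T x = x.
Proof.
have [Cx [n n_gt0 nx]] := x_periodic.
pose u k := iter k T x.
have Cu k : C (u k) by elim: k => //= k; exact: T_maps_C.
have uD k : u (k + n)%N = u k by rewrite /u iterD nx.
pose S m := \sum_(k < n) mdist (u k) (u (k + m)%N).
(* By periodicity the shift permutes the terms cyclically: with the term of index 0 added, both
   sides become the sum over [k < n.+1], whose last term equals its first. *)
have shift m : \sum_(k < n) mdist (u k.+1) (u (k.+1 + m)%N) = S m.
  apply: (addrI (mdist (u 0%N) (u (0 + m)%N))).
  rewrite -(big_ord_recl n (fun k : 'I_n.+1 => mdist (u k) (u (k + m)%N))).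
  have un : u n = u 0%N by rewrite -[RHS]uD.
  by rewrite big_ord_recr /= addrC un addnC uD.
have SS m : 2 * S m.+1 <= S m + S m.+2.
  have : \sum_(k < n) mdist (u k.+1) (u (k.+1 + m.+1)%N) <=
      \sum_(k < n) ((1 - l) ^+ 2 * mdist (u k) (u (k + m.+1)%N)
        + l ^+ 2 * mdist (u k.+1) (u (k.+1 + m.+1)%N)
        + l * (1 - l) * (mdist (u k) (u (k + m.+2)%N)
                         + mdist (u k.+1) (u (k.+1 + m)%N))).
    apply: ler_sum => k _; rewrite (addnS k m.+1) (addSnnS k m) addSn.
    apply: le_trans (T_firm (u k) (u (k + m.+1)%N) (Cu _) (Cu _)) _.
    exact: (dist_comb_le busemannX (u k) (T (u k)) _ _ l_gt0 l_lt1).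
  rewrite !big_split /= -!mulr_sumr big_split /= !shift -!/(S _) => H.
  (* Since [1 - (1 - l)^2 - l^2 = 2 * l * (1 - l)], moving the [S m.+1] terms of [H] to the left
     leaves the common factor [l * (1 - l)], which cancels. *)
  have l0 : 0 < l * (1 - l) by rewrite mulr_gt0 ?subr_gt0.
  by rewrite -(ler_pM2l l0); lra.
have S0 : S 0%N = 0 by apply: big1 => k _; rewrite addn0 mdistxx.
have Sn : S n = 0 by apply: big1 => k _; rewrite uD mdistxx.
have := midconvex_ge_linear S0 SS n; rewrite Sn pmulr_rle0 ?ltr0n // => S1.
have : mdist (u 0%N) (u 1%N) <= 0.
  apply: le_trans S1; rewrite /S (bigD1 (Ordinal n_gt0)) //= lerDl.
  by apply: sumr_ge0 => k _; exact: mdist_ge0.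
move=> d0; apply/esym/mdist_positivity/le_anti.
by rewrite d0 mdist_ge0.
Qed.
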